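(* Let $L$ be the Lie ring over $\mathbb{Z}$ generated by $e_1,\dots,e_{10}$ subject to the relations $$[e_{i+1},e_i,e_i]=0,\quad [e_i,e_{i+1},e_{i+1}]=0\qquad (1\le i\le 9),$$ $$[e_j,e_i]=0\qquad (1\le i,\ i+2\le j\le 10),$$ $$[e_{i+2},e_{i+1},e_i,e_{i+1}]=0\qquad (1\le i\le 8).$$ Then $L$ is nilpotent of class $10$, and for each $1\le i\le 10$ the additive group of the lower central factor $L^i/L^{i+1}$ is a direct sum of $11-i$ infinite cyclic groups: $$L^i/L^{i+1}\cong C_\infty\oplus\cdots\oplus C_\infty\quad (11-i\text{ summands}).$$
   Context: Products are left-normed: $[a,b,c]=[[a,b],c]$ and $[a,b,c,d]=[[[a,b],c],d]$. $L^i$ denotes the $i$th term of the lower central series ($L^1=L$, $L^{i+1}=[L^i,L]$), and $C_\infty$ is the infinite cyclic group. *)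

(* Defs.v *)
From HB Require Import structures.
From mathcomp Require Import all_boot all_order all_algebra.
From mathcomp Require Import boolp.

Set Implicit Arguments.
Unset Strict Implicit.
Unset Printing Implicit Defensive.

Import GRing.Theory.
Local Open Scope ring_scope.
Local Open Scope quotient_scope.

HB.mixin Record Zmodule_isLieRing L of GRing.Zmodule L := {
  lie : L -> L -> L;
  lieDl : forall x y z, lie (x + y) z = lie x z + lie y z;
  lieDr : forall x y z, lie x (y + z) = lie x y + lie x z;
  liexx : forall x, lie x x = 0;
  lie_jacobi : forall x y z,
    lie (lie x y) z + lie (lie y z) x + lie (lie z x) y = 0
}.

#[short(type="lieRingType")]
HB.structure Definition LieRing := {L of GRing.Zmodule L & Zmodule_isLieRing L}.

Inductive lie_term (X : Type) : Type :=
| TGen of X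
| TZero
| TOpp of lie_term X
| TAdd of lie_term X & lie_term X
| TLie of lie_term X & lie_term X.

Arguments TZero {X}.

HB.instance Definition _ (X : Type) := gen_eqMixin (lie_term X).
HB.instance Definition _ (X : Type) := gen_choiceMixin (lie_term X).

(* Left-normed products: [lie a, b, c] is [[a, b], c]. *)
Notation "[ 'lie' x , y , .. , z ]" := (TLie .. (TLie x y) .. z)
  (at level 0, format "[ 'lie'  x ,  y ,  .. ,  z ]").

(* Equality of terms forced by the Lie ring axioms and by [r = 0] for every
   relator [r] in [R]. *)
Inductive lie_eq (X : Type) (R : lie_term X -> Prop) :
    lie_term X -> lie_term X -> Prop :=
| LE_refl s : lie_eq R s s
| LE_sym s t : lie_eq R s t -> lie_eq R t s
| LE_trans s t u : lie_eq R s t -> lie_eq R t u -> lie_eq R s u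
| LE_opp s s' : lie_eq R s s' -> lie_eq R (TOpp s) (TOpp s')
| LE_add s s' t t' :
    lie_eq R s s' -> lie_eq R t t' -> lie_eq R (TAdd s t) (TAdd s' t')
| LE_lie s s' t t' :
    lie_eq R s s' -> lie_eq R t t' -> lie_eq R (TLie s t) (TLie s' t')
| LE_addA s t u : lie_eq R (TAdd s (TAdd t u)) (TAdd (TAdd s t) u)
| LE_addC s t : lie_eq R (TAdd s t) (TAdd t s)
| LE_add0 s : lie_eq R (TAdd TZero s) s
| LE_addN s : lie_eq R (TAdd (TOpp s) s) TZero
| LE_lieDl s t u :
    lie_eq R (TLie (TAdd s t) u) (TAdd (TLie s u) (TLie t u))
| LE_lieDr s t u :
    lie_eq R (TLie s (TAdd t u)) (TAdd (TLie s t) (TLie s u))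
| LE_liexx s : lie_eq R (TLie s s) TZero
| LE_jacobi s t u :
    lie_eq R (TAdd (TAdd [lie s, t, u] [lie t, u, s]) [lie u, s, t]) TZero
| LE_rel r : R r -> lie_eq R r TZero.

Section Presentation.
Variables (X : Type) (R : lie_term X -> Prop).

Definition lie_eqb (s t : lie_term X) : bool := `[< lie_eq R s t >].

Lemma lie_eqb_equiv : equiv_class_of lie_eqb.
Proof.
split=> [s|s t|t s u].
- exact/asboolP/LE_refl.
- by apply/asboolP/asboolP; exact: LE_sym.
- by move=> /asboolP st /asboolP tu; apply/asboolP; exact: LE_trans st tu.
Qed.

Canonical lie_eqb_equivRel := EquivRelPack lie_eqb_equiv.
Canonical lie_eqb_encModRel := defaultEncModRel lie_eqb.

Definition lie_pres := {eq_quot lie_eqb}.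

HB.instance Definition _ : EqQuotient _ lie_eqb lie_pres :=
  EqQuotient.on lie_pres.
HB.instance Definition _ := Choice.on lie_pres.

Lemma pres_eqP (s t : lie_term X) :
  lie_eq R s t <-> \pi_lie_pres s = \pi_lie_pres t.
Proof.
split=> [st|/eqP]; first by apply/eqP; rewrite piE; exact/asboolP.
by rewrite piE => /asboolP.
Qed.

Definition pres_zero : lie_pres := \pi_lie_pres TZero.
Definition pres_opp (x : lie_pres) : lie_pres := \pi_lie_pres (TOpp (repr x)).
Definition pres_add (x y : lie_pres) : lie_pres :=
  \pi_lie_pres (TAdd (repr x) (repr y)).
Definition pres_lie (x y : lie_pres) : lie_pres :=
  \pi_lie_pres (TLie (repr x) (repr y)).

Lemma repr_pi s : lie_eq R (repr (\pi_lie_pres s)) s.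
Proof. by apply/pres_eqP; rewrite reprK. Qed.

Lemma pi_pres_opp s : pres_opp (\pi_lie_pres s) = \pi_lie_pres (TOpp s).
Proof. by apply/pres_eqP/LE_opp/repr_pi. Qed.

Lemma pi_pres_add s t : pres_add (\pi_lie_pres s) (\pi_lie_pres t) = \pi_lie_pres (TAdd s t).
Proof. by apply/pres_eqP/LE_add; apply: repr_pi. Qed.

Lemma pi_pres_lie s t : pres_lie (\pi_lie_pres s) (\pi_lie_pres t) = \pi_lie_pres (TLie s t).
Proof. by apply/pres_eqP/LE_lie; apply: repr_pi. Qed.

Lemma pi_ex (x : lie_pres) : exists s, x = \pi_lie_pres s.
Proof. by exists (repr x); rewrite reprK. Qed.

Let piEs := (pi_pres_opp, pi_pres_add, pi_pres_lie).

Lemma pres_addA : associative pres_add.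
Proof.
move=> x y z; have [s ->] := pi_ex x; have [t ->] := pi_ex y.
by have [u ->] := pi_ex z; rewrite !piEs; apply/pres_eqP/LE_addA.
Qed.

Lemma pres_addC : commutative pres_add.
Proof. by move=> x y; apply/pres_eqP/LE_addC. Qed.

Lemma pres_add0 : left_id pres_zero pres_add.
Proof.
by move=> x; have [s ->] := pi_ex x; rewrite piEs; apply/pres_eqP/LE_add0.
Qed.

Lemma pres_addN : left_inverse pres_zero pres_opp pres_add.
Proof.
by move=> x; have [s ->] := pi_ex x; rewrite !piEs; apply/pres_eqP/LE_addN.
Qed.

HB.instance Definition _ :=
  GRing.isZmodule.Build lie_pres pres_addA pres_addC pres_add0 pres_addN.

Lemma piDE s t : \pi_lie_pres s + \pi_lie_pres t = \pi_lie_pres (TAdd s t).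
Proof. exact: pi_pres_add. Qed.

Lemma piNE s : - \pi_lie_pres s = \pi_lie_pres (TOpp s).
Proof. exact: pi_pres_opp. Qed.

Lemma pres_lieDl x y z : pres_lie (x + y) z = pres_lie x z + pres_lie y z.
Proof.
have [s ->] := pi_ex x; have [t ->] := pi_ex y; have [u ->] := pi_ex z.
by rewrite !(piDE, piEs); apply/pres_eqP/LE_lieDl.
Qed.

Lemma pres_lieDr x y z : pres_lie x (y + z) = pres_lie x y + pres_lie x z.
Proof.
have [s ->] := pi_ex x; have [t ->] := pi_ex y; have [u ->] := pi_ex z.
by rewrite !(piDE, piEs); apply/pres_eqP/LE_lieDr.
Qed.

Lemma pres_liexx x : pres_lie x x = 0.
Proof. by have [s ->] := pi_ex x; rewrite piEs; apply/pres_eqP/LE_liexx. Qed.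

Lemma pres_jacobi x y z :
  pres_lie (pres_lie x y) z + pres_lie (pres_lie y z) x
    + pres_lie (pres_lie z x) y = 0.
Proof.
have [s ->] := pi_ex x; have [t ->] := pi_ex y; have [u ->] := pi_ex z.
by rewrite !(piDE, piEs); apply/pres_eqP/LE_jacobi.
Qed.

HB.instance Definition _ := Zmodule_isLieRing.Build lie_pres
  pres_lieDl pres_lieDr pres_liexx pres_jacobi.

Definition pres_gen (x : X) : lie_pres := \pi_lie_pres (TGen x).

End Presentation.

Fixpoint lie_eval (X : Type) (M : lieRingType) (f : X -> M) (t : lie_term X) :
    M :=
  match t with
  | TGen x => f x
  | TZero => 0
  | TOpp s => - lie_eval f s
  | TAdd s u => lie_eval f s + lie_eval f u
  | TLie s u => lie (lie_eval f s) (lie_eval f u)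
  end.

Lemma pres_relator (X : Type) (R : lie_term X -> Prop) r :
  R r -> lie_eval (@pres_gen X R) r = 0.
Proof.
have evalE t : lie_eval (@pres_gen X R) t = \pi t.
  elim: t => [x||s IHs|s IHs t IHt|s IHs t IHt] //=.
  - by rewrite IHs; apply: pi_pres_opp.
  - by rewrite IHs IHt; apply: pi_pres_add.
  - by rewrite IHs IHt; apply: pi_pres_lie.
by move=> Rr; rewrite evalE; apply/pres_eqP/LE_rel.
Qed.

Lemma pres_universal (X : Type) (R : lie_term X -> Prop) (M : lieRingType)
    (f : X -> M) :
  (forall r, R r -> lie_eval f r = 0) ->
  exists! h : lie_pres R -> M,
    [/\ {morph h : x y / x + y}, {morph h : x y / lie x y}
      & forall x, h (pres_gen R x) = f x].
Proof.
move=> fR.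
have evalP s t : lie_eq R s t -> lie_eval f s = lie_eval f t.
  elim=> {s t} //=.
  - by move=> s t u _ -> _ ->.
  - by move=> s s' _ ->.
  - by move=> s s' t t' _ -> _ ->.
  - by move=> s s' t t' _ -> _ ->.
  - by move=> s t u; rewrite addrA.
  - by move=> s t; rewrite addrC.
  - by move=> s; rewrite add0r.
  - by move=> s; rewrite addNr.
  - by move=> s t u; rewrite lieDl.
  - by move=> s t u; rewrite lieDr.
  - by move=> s; rewrite liexx.
  - by move=> s t u; rewrite lie_jacobi.
exists (fun x => lie_eval f (repr x)); split.
  by split=> [x y|x y|x]; rewrite (evalP _ _ (repr_pi _ _)).
move=> h [hD hL hG]; apply/funext => x.
have hZ : h 0 = 0 by apply: (@addrI _ (h 0)); rewrite -hD !addr0.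
rewrite -[x in RHS]reprK.
elim: (repr x) => [y||s IHs|s IHs t IHt|s IHs t IHt] /=.
- by rewrite -hG.
- by rewrite -[LHS]hZ.
- by rewrite -piNE IHs; apply: (@addrI _ (h (\pi s))); rewrite -hD !subrr hZ.
- by rewrite -pi_pres_add IHs IHt -hD.
- by rewrite -pi_pres_lie IHs IHt -hL.
Qed.

Inductive zspan (V : zmodType) (A : V -> Prop) : V -> Prop :=
| Zspan_in x : A x -> zspan A x
| Zspan0 : zspan A 0
| ZspanB x y : zspan A x -> zspan A y -> zspan A (x - y).

Definition zgen (V : zmodType) (A : V -> Prop) : {pred V} :=
  fun x => `[< zspan A x >].

Lemma zgen_closed (V : zmodType) (A : V -> Prop) : zmod_closed (zgen A).
Proof.
split=> [|x y /asboolP Ax /asboolP Ay]; apply/asboolP; first exact: Zspan0.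
exact: ZspanB.
Qed.

HB.instance Definition _ (V : zmodType) (A : V -> Prop) :=
  GRing.isZmodClosed.Build V (zgen A) (zgen_closed A).

Record subgrp (V : zmodType) (H : zmodClosed V) : Type :=
  Subgrp { subgrp_val : V; _ : subgrp_val \in H }.

HB.instance Definition _ (V : zmodType) (H : zmodClosed V) :=
  [isSub for @subgrp_val V H].
HB.instance Definition _ (V : zmodType) (H : zmodClosed V) :=
  [Choice of subgrp H by <:].
HB.instance Definition _ (V : zmodType) (H : zmodClosed V) :=
  [SubChoice_isSubZmodule of subgrp H by <:].

Definition subgrp_trace (V : zmodType) (H K : zmodClosed V) :
    {pred subgrp H} :=
  fun x => val x \in K.

Arguments subgrp_trace [V] H K.

Lemma subgrp_trace_closed (V : zmodType) (H K : zmodClosed V) :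
  zmod_closed (subgrp_trace H K).
Proof.
by split=> [|x y Kx Ky]; rewrite unfold_in /subgrp_trace ?raddf0 ?rpred0
  // raddfB rpredB.
Qed.

HB.instance Definition _ (V : zmodType) (H K : zmodClosed V) :=
  GRing.isZmodClosed.Build (subgrp H) (subgrp_trace H K)
    (subgrp_trace_closed H K).

(* H / (H :&: K), that is, H / K when K is contained in H. *)
Definition subquot (V : zmodType) (H K : zmodClosed V) : zmodType :=
  Quotient.quot (subgrp_trace H K).

Definition zmod_isog (U V : zmodType) : Prop :=
  exists f : {additive U -> V}, bijective f.

Section LowerCentral.
Variable L : lieRingType.

Definition lie_comm (A B : {pred L}) : {pred L} :=
  zgen (fun z => exists a b, [/\ a \in A, b \in B & z = lie a b]).

(* $L^i$ for [i >= 1]; the index [0] also gives $L$. *)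
Definition lower_central (i : nat) : {pred L} :=
  iter i.-1 (fun A : {pred L} => lie_comm A predT) predT.

Lemma lower_central_closed i : zmod_closed (lower_central i).
Proof. by case: i => [|[|i]] //; apply: zgen_closed. Qed.

HB.instance Definition _ i :=
  GRing.isZmodClosed.Build L (lower_central i) (lower_central_closed i).

Lemma lower_central_sub i x :
  x \in lower_central i.+1 -> x \in lower_central i.
Proof.
case: i => // i; elim: i x => // i IHi x /asboolP xi; apply/asboolP.
elim: xi => [_ [a [b [ai _ ->]]]||*]; [|exact: Zspan0|exact: ZspanB].
by apply: Zspan_in; exists a, b; split=> //; apply: IHi.
Qed.

Definition lower_central_factor (i : nat) : zmodType :=
  subquot (lower_central i) (lower_central i.+1).

Definition lower_central_trivial (i : nat) : Prop :=
  forall x : L, x \in lower_central i -> x = 0.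

Definition nilpotent_of_class (c : nat) : Prop :=
  lower_central_trivial c.+1 /\
  forall d, (d < c)%N -> ~ lower_central_trivial d.+1.

End LowerCentral.

(* Meaningful for 1 <= i <= 10: ['I_10] counts from 0. *)
Definition e (i : nat) : lie_term 'I_10 := TGen (inord i.-1).

Inductive relator : lie_term 'I_10 -> Prop :=
| Rel_right i : (1 <= i <= 9)%N -> relator [lie e i.+1, e i, e i]
| Rel_left i : (1 <= i <= 9)%N -> relator [lie e i, e i.+1, e i.+1]
| Rel_comm i j : (1 <= i)%N -> (i + 2 <= j <= 10)%N -> relator [lie e j, e i]
| Rel_four i : (1 <= i <= 8)%N ->
    relator [lie e i.+2, e i.+1, e i, e i.+1].

Definition L : lieRingType := lie_pres relator.

(* Main.v *)
Require Import Defs.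
From mathcomp Require Import all_boot all_order all_algebra.
From HB Require Import structures.
From mathcomp Require Import boolp zify.

(** The ring [L] is the Lie ring of strictly upper triangular integer matrices
    of size 11, the generators [e_1, ..., e_10] being the matrix units just
    above the diagonal; the term [L^i] then consists of the matrices supported
    on the [i]-th superdiagonal and beyond, and that superdiagonal has
    [11 - i] entries.

    That [L] is no larger is shown by working with the left-normed products
    of consecutive generators [g_i, g_(i+1), ..., g_(i+k)], the root elements
    [root_elt i k]. The bracket of such a product with a generator is a longer
    root element, up to sign, if the generator extends the string at one of its
    ends ([root_gen_right], [root_gen_left]), and zero otherwise. If the
    generator is far from the string this is commutation
    ([root_gen_far_right], [root_gen_far_left]); if it occurs in the string,
    stripping end letters that commute with it leaves at most three letters,
    where the relations of degree 3 and 4 apply ([root_gen_inner]). Hence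
    bracketing with any element maps the span of the root elements with more
    than [m] letters to the span of those with more than [m.+1] letters, and
    these spans are exactly the lower central terms ([lower_centralP]).

    That [L] is no smaller follows from the homomorphism to matrices that
    exists because the matrix units satisfy the relations ([toM_exists]). It
    sends [root_elt i k] to the matrix unit at [(i, i + k + 1)], so the entries
    on the [(m+1)]-st superdiagonal are coordinates on [L^(m+1)], and their
    common kernel there is [L^(m+2)] ([diag_ker]); a root element with [m + 1]
    letters can be prescribed for each of these entries, so every integer
    vector occurs ([undiagK]). *)

Set Implicit Arguments.
Unset Strict Implicit.
Unset Printing Implicit Defensive.

Import GRing.Theory.
Local Open Scope ring_scope.
Local Open Scope quotient_scope.

(** * Elementary identities in Lie rings *)

Section LieIdentities.
Variable M : lieRingType.
Implicit Types a b c : M.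

Lemma lie0r a : lie 0 a = 0.
Proof. by apply: (@addrI _ (lie 0 a)); rewrite -lieDl !addr0. Qed.

Lemma lier0 a : lie a 0 = 0.
Proof. by apply: (@addrI _ (lie a 0)); rewrite -lieDr !addr0. Qed.

Lemma lieNl a b : lie (- a) b = - lie a b.
Proof. by apply: (@addrI _ (lie a b)); rewrite -lieDl !subrr lie0r. Qed.

Lemma lieNr a b : lie a (- b) = - lie a b.
Proof. by apply: (@addrI _ (lie a b)); rewrite -lieDr !subrr lier0. Qed.

Lemma lieC a b : lie a b = - lie b a.
Proof.
apply/eqP; rewrite -subr_eq0 opprK; apply/eqP.
by have := liexx (a + b); rewrite lieDl !lieDr !liexx add0r addr0.
Qed.

Lemma lie_derivr a b c : lie (lie a b) c = lie (lie a c) b + lie a (lie b c).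
Proof.
apply/eqP; rewrite -subr_eq0 (lieC a (lie b c)) (lieC a c) lieNl.
by rewrite opprD !opprK [X in _ + X]addrC addrA lie_jacobi.
Qed.

Lemma lie_lier a b c : lie a (lie b c) = lie (lie a b) c - lie (lie a c) b.
Proof. by rewrite (lie_derivr a b c) addrAC subrr add0r. Qed.

Lemma lie_lie0 a b c : lie a c = 0 -> lie b c = 0 -> lie (lie a b) c = 0.
Proof. by move=> ac bc; rewrite lie_derivr ac bc lie0r lier0 addr0. Qed.

End LieIdentities.

(** * Spans *)

Section Span.
Variable V : zmodType.
Implicit Types (A : V -> Prop) (K : zmodClosed V).

Lemma zgen_in A x : A x -> x \in zgen A.
Proof. by move=> Ax; apply/asboolP/Zspan_in. Qed.

Lemma zgen_ind A (P : V -> Prop) :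
  (forall x, A x -> P x) -> P 0 -> (forall x y, P x -> P y -> P (x - y)) ->
  forall x, x \in zgen A -> P x.
Proof. by move=> PA P0 PB x /asboolP; elim=> *; auto. Qed.

End Span.

(** * Root elements and the lower central series *)

Section Roots.
Variables (M : lieRingType) (g : nat -> M).

Fixpoint root_elt (i k : nat) : M :=
  if k is l.+1 then lie (root_elt i l) (g (i + k)) else g i.

(** Indexing by all natural numbers removes boundary conditions from the
    statements below; a finite family is extended by zero. *)
Hypothesis rel_right : forall i, lie (lie (g i.+1) (g i)) (g i) = 0.
Hypothesis rel_left : forall i, lie (lie (g i) (g i.+1)) (g i.+1) = 0.
Hypothesis rel_comm : forall i j, (i + 2 <= j)%N -> lie (g j) (g i) = 0.
Hypothesis rel_four :
  forall i, lie (lie (lie (g i.+2) (g i.+1)) (g i)) (g i.+1) = 0.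
Hypothesis gen_ind : forall P : M -> Prop, (forall i, P (g i)) ->
  (forall x y, P x -> P y -> P (x - y)) ->
  (forall x y, P x -> P y -> P (lie x y)) -> forall x, P x.

Lemma root_gen_right i k : lie (root_elt i k) (g (i + k).+1) = root_elt i k.+1.
Proof. by rewrite /= addnS. Qed.

Lemma root_gen_far_right i k j :
  (i + k + 2 <= j)%N -> lie (root_elt i k) (g j) = 0.
Proof.
elim: k => [|k IHk] hj /=; first by rewrite lieC rel_comm ?oppr0//; lia.
by apply: lie_lie0; [apply: IHk; lia | rewrite lieC rel_comm ?oppr0//; lia].
Qed.

Lemma root_gen_far_left i k j : (j + 2 <= i)%N -> lie (root_elt i k) (g j) = 0.
Proof.
elim: k => [|k IHk] hj /=; first by rewrite rel_comm.
by apply: lie_lie0; [apply: IHk | rewrite rel_comm//; lia].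
Qed.

Lemma root_cat i k l :
  lie (root_elt i k) (root_elt (i + k).+1 l) = root_elt i (k + l).+1.
Proof.
elim: l => [|l IHl]; first by rewrite addn0 root_gen_right.
rewrite [root_elt _ l.+1]/= lie_lier IHl (@root_gen_far_right i k); last lia.
by rewrite lie0r subr0 (addnS k) /=; congr (lie _ (g _)); lia.
Qed.

Lemma root_gen_left i k : lie (root_elt i.+1 k) (g i) = - root_elt i k.+1.
Proof. by rewrite lieC -[g i]/(root_elt i 0) -{2}[i]addn0 root_cat. Qed.

(** An end letter at distance at least two from [j] commutes with [g j] and
    can be split off. What remains is [g j] itself, a product of two letters
    one of which is [g j], or a product of three letters centred at [j]; these
    are killed by alternation and by the relations of degree 3 and 4. *)
Lemma root_gen_inner i k j :
  (i <= j <= i + k)%N -> lie (root_elt i k) (g j) = 0.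
Proof.
elim: k i j => [|k IHk] i j hj.
  have -> : j = i by lia.
  exact: liexx.
have [far|near] := leqP (i + 2) j.
  rewrite -[k]add0n -root_cat addn0; apply: lie_lie0.
    by rewrite lieC rel_comm ?oppr0.
  by apply: IHk; lia.
have [far'|near'] := leqP (j + 2) (i + k.+1).
  by apply: lie_lie0; [apply: IHk; lia | rewrite rel_comm].
have [[k0 ji]|[[k0 ji]|[k1 ji]]] :
  (k = 0 /\ j = i \/ k = 0 /\ j = i.+1 \/ k = 1 /\ j = i.+1)%N by lia.
- by rewrite k0 ji /= addn1 (lieC (g i)) lieNl rel_right oppr0.
- by rewrite k0 ji /= addn1 rel_left.
(* The degree-four relation has its letters in descending order, so the
   product is rebracketed as g_i times the product of the other two. *)
- rewrite k1 ji -(root_cat i 0 1) addn0 /= addn1.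
  by rewrite (lieC (g i)) (lieC (g i.+1)) !lieNl opprK rel_four.
Qed.

(** By [lower_centralP] this is the [(m+1)]-st lower central term: as [k]
    counts from zero, [root_elt i k] has [k + 1] letters. *)
Definition long_span (m : nat) : {pred M} :=
  zgen (fun x => exists i k, (m <= k)%N /\ x = root_elt i k).

HB.instance Definition _ m := GRing.isZmodClosed.Build M (long_span m)
  (zgen_closed (fun x => exists i k, (m <= k)%N /\ x = root_elt i k)).

Lemma root_long m i k : (m <= k)%N -> root_elt i k \in long_span m.
Proof. by move=> mk; apply: zgen_in; exists i, k. Qed.

Lemma long_span_le m x : x \in long_span m.+1 -> x \in long_span m.
Proof.
move: x; apply: zgen_ind => [_ [i [k [mk ->]]]||]; last exact: rpredB.
  by apply: root_long; exact: ltnW.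
exact: rpred0.
Qed.

Lemma long_span_lie_gen m x j :
  x \in long_span m -> lie x (g j) \in long_span m.+1.
Proof.
move: x; apply: zgen_ind => [_ [i [k [mk ->]]]||x y hx hy].
- have [hj|[hj|[hj|[hj|hj]]]] : (i + k + 2 <= j \/ j = (i + k).+1 \/
    i <= j <= i + k \/ i = j.+1 \/ j + 2 <= i)%N by lia.
  + by rewrite root_gen_far_right ?rpred0.
  + by rewrite hj root_gen_right root_long.
  + by rewrite root_gen_inner ?rpred0.
  + by rewrite hj root_gen_left rpredN root_long.
  + by rewrite root_gen_far_left ?rpred0.
- by rewrite lie0r rpred0.
- by rewrite lieDl lieNl rpredB.
Qed.

(** The elements [y] with this property for all [m] form a subring: for
    [y = [u, v]] the Jacobi identity writes [[x, y]] with two successive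
    brackets, which even gain two letters. *)
Lemma long_span_lie m x y :
  x \in long_span m -> lie x y \in long_span m.+1.
Proof.
move: y m x; apply: gen_ind => [j|y z hy hz|y z hy hz] m x hx.
- exact: long_span_lie_gen.
- by rewrite lieDr lieNr rpredB//; [apply: hy | apply: hz].
- rewrite lie_lier; apply: rpredB; apply: long_span_le.
    by apply/hz/hy.
  by apply/hy/hz.
Qed.

Lemma long_span0 x : x \in long_span 0.
Proof.
move: x; apply: gen_ind => [i|x y hx hy|x y hx hy].
- exact: (root_long i (leqnn 0)).
- exact: rpredB.
- exact/long_span_le/long_span_lie.
Qed.

(** A root element with [m + 2] letters is by definition the bracket of one with
    [m + 1] letters and a generator, which gives one inclusion; the other is
    [long_span_lie]. *)
Lemma lower_centralP m x :
  (x \in lower_central m.+1) = (x \in long_span m).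
Proof.
apply/idP/idP; elim: m x => [|m IHm] x.
- by move=> _; apply: long_span0.
- move: x; apply: zgen_ind => [_ [a [b [am _ ->]]]||]; last exact: rpredB.
    by apply/long_span_lie/IHm.
  exact: rpred0.
- by [].
- move: x; apply: zgen_ind => [_ [i [[|k] [mk ->]]]||]; first lia.
  + by apply: zgen_in; exists (root_elt i k), (g (i + k.+1)); split=> //;
      apply/IHm/root_long.
  + exact: rpred0.
  + exact: rpredB.
Qed.

End Roots.

(** * Integer matrices as a Lie ring *)

Section Matrices.
Variable n : nat.

Definition gl : Type := 'M[int]_n.
HB.instance Definition _ := GRing.Zmodule.on gl.

Definition mx_comm (A B : gl) : gl := A *m B - B *m A.

Lemma mx_commDl A B C : mx_comm (A + B) C = mx_comm A C + mx_comm B C.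
Proof. by rewrite /mx_comm mulmxDl mulmxDr opprD addrACA. Qed.

Lemma mx_commDr A B C : mx_comm A (B + C) = mx_comm A B + mx_comm A C.
Proof. by rewrite /mx_comm mulmxDl mulmxDr opprD addrACA. Qed.

Lemma mx_commxx A : mx_comm A A = 0.
Proof. exact: subrr. Qed.

Lemma mx_comm_jacobi A B C :
  mx_comm (mx_comm A B) C + mx_comm (mx_comm B C) A + mx_comm (mx_comm C A) B
  = 0.
Proof.
rewrite /mx_comm !(mulmxBl, mulmxBr) !mulmxA !opprB.
have mxD (X Y : gl) i j : (X + Y) i j = X i j + Y i j by rewrite mxE.
have mxN (X : gl) i j : (- X) i j = - X i j by rewrite mxE.
(* The six products of A, B, C in all orders, each with both signs. *)
have six_terms (a b c d e f : int) :
  a - b + (c - d) + (e - c + (f - a)) + (d - f + (b - e)) = 0 by lia.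
by apply/matrixP => i j; rewrite !(mxD, mxN) [RHS]mxE; apply: six_terms.
Qed.

HB.instance Definition _ := Zmodule_isLieRing.Build gl
  mx_commDl mx_commDr mx_commxx mx_comm_jacobi.

End Matrices.

(** Indexing matrix units by natural numbers matches the indexing of the root
    elements; [munit a b] is meaningful for [a, b <= 10]. *)
Definition munit (a b : nat) : gl 11 := delta_mx (inord a) (inord b).

Lemma lie_munit a b c d :
  (a <= 10)%N -> (b <= 10)%N -> (c <= 10)%N -> (d <= 10)%N ->
  lie (munit a b) (munit c d)
  = munit a d *+ (b == c) - munit c b *+ (d == a).
Proof.
have inord_eq u v : (u <= 10)%N -> (v <= 10)%N ->
    (inord u == inord v :> 'I_11) = (u == v).
  by move=> hu hv; rewrite -val_eqE /= !inordK.
move=> ha hb hc hd; rewrite /lie /= /mx_comm /munit.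
by rewrite !mul_delta_mx_cond !inord_eq.
Qed.

Lemma munitE a b c d : (a <= 10)%N -> (b <= 10)%N -> (c <= 10)%N ->
  (d <= 10)%N -> munit a b (inord c) (inord d) = ((c == a) && (d == b))%:R.
Proof. by move=> *; rewrite mxE -!val_eqE /= !inordK. Qed.

Definition mgen (i : 'I_10) : gl 11 := munit i i.+1.

Lemma mgen_inord i : (i < 10)%N -> mgen (inord i) = munit i i.+1.
Proof. by move=> hi; rewrite /mgen inordK. Qed.

Lemma mgen_relator r : relator r -> lie_eval mgen r = 0.
Proof.
have neqE (a b : nat) : a <> b -> (a == b) = false by move/eqP/negbTE.
case=> {r} [[|i] hi|[|i] hi|[|i] [|j] hi hj|[|i] hi] //=; try lia;
  rewrite !mgen_inord; try lia.
- rewrite lie_munit; try lia.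
  rewrite eqxx neqE; last lia.
  rewrite mulr0n mulr1n sub0r lieNl lie_munit; try lia.
  rewrite !neqE; try lia.
  by rewrite !mulr0n subr0 oppr0.
- rewrite lie_munit; try lia.
  rewrite eqxx neqE; last lia.
  rewrite mulr0n mulr1n subr0 lie_munit; try lia.
  rewrite !neqE; try lia.
  by rewrite !mulr0n subr0.
- rewrite lie_munit; try lia.
  rewrite !neqE; try lia.
  by rewrite !mulr0n subr0.
- rewrite lie_munit; try lia.
  rewrite eqxx neqE; last lia.
  rewrite mulr0n mulr1n sub0r lieNl lie_munit; try lia.
  rewrite eqxx neqE; last lia.
  rewrite mulr0n mulr1n sub0r opprK lie_munit; try lia.
  rewrite !neqE; try lia.
  by rewrite !mulr0n subr0.
Qed.

Lemma toM_exists : exists h : L -> gl 11,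
  [/\ {morph h : x y / x + y}, {morph h : x y / lie x y}
    & forall i, h (pres_gen relator i) = mgen i].
Proof. by have [h [hP _]] := pres_universal mgen_relator; exists h. Qed.

(** * The root elements of [L] *)

(** Extension by zero keeps all the defining relations true for every natural
    index. *)
Definition gen (k : nat) : L :=
  if (k < 10)%N then pres_gen relator (inord k) else 0.

Lemma lie_pres_ind (X : Type) (R : lie_term X -> Prop)
    (P : lie_pres R -> Prop) :
  (forall x, P (pres_gen R x)) -> P 0 ->
  (forall x y, P x -> P y -> P (x - y)) ->
  (forall x y, P x -> P y -> P (lie x y)) -> forall x, P x.
Proof.
move=> PG P0 PB PL x; have PN y : P y -> P (- y).
  by move=> Py; rewrite -sub0r; apply: PB.
rewrite -[x]reprK; elim: (repr x) => [y||s IHs|s IHs t IHt|s IHs t IHt].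
- exact: PG.
- exact: P0.
- by rewrite -piNE; apply: PN.
- by rewrite -piDE -[\pi t]opprK; apply: PB => //; apply: PN.
- by rewrite -pi_pres_lie; apply: PL.
Qed.

Lemma gen_ind (P : L -> Prop) : (forall i, P (gen i)) ->
  (forall x y, P x -> P y -> P (x - y)) ->
  (forall x y, P x -> P y -> P (lie x y)) -> forall x, P x.
Proof.
move=> PG PB PL; apply: lie_pres_ind => // [i|].
  by have := PG i; rewrite /gen ltn_ord inord_val.
by rewrite -(subrr (gen 0)); apply: PB.
Qed.

Lemma gen_large i : (10 <= i)%N -> gen i = 0.
Proof. by move=> hi; rewrite /gen ltnNge hi. Qed.

Lemma gen_small i : (i < 10)%N -> gen i = pres_gen relator (inord i).
Proof. by move=> hi; rewrite /gen hi. Qed.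

Lemma gen_right i : lie (lie (gen i.+1) (gen i)) (gen i) = 0.
Proof.
have [hi|hi] := ltnP i 9; last by rewrite (@gen_large i.+1) ?lie0r.
rewrite !gen_small; try lia.
by apply: (@pres_relator _ relator [lie e i.+2, e i.+1, e i.+1]);
  constructor; lia.
Qed.

Lemma gen_left i : lie (lie (gen i) (gen i.+1)) (gen i.+1) = 0.
Proof.
have [hi|hi] := ltnP i 9; last by rewrite (@gen_large i.+1) ?lier0.
rewrite !gen_small; try lia.
by apply: (@pres_relator _ relator [lie e i.+1, e i.+2, e i.+2]);
  constructor; lia.
Qed.

Lemma gen_comm i j : (i + 2 <= j)%N -> lie (gen j) (gen i) = 0.
Proof.
move=> ij; have [hj|hj] := ltnP j 10; last by rewrite (gen_large hj) lie0r.
rewrite !gen_small; try lia.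
by apply: (@pres_relator _ relator [lie e j.+1, e i.+1]); constructor; lia.
Qed.

Lemma gen_four i :
  lie (lie (lie (gen i.+2) (gen i.+1)) (gen i)) (gen i.+1) = 0.
Proof.
have [hi|hi] := ltnP i 8; last by rewrite (@gen_large i.+2) ?lie0r.
rewrite !gen_small; try lia.
by apply: (@pres_relator _ relator [lie e i.+3, e i.+2, e i.+1, e i.+2]);
  constructor; lia.
Qed.

Lemma lower_centralE m y :
  (y \in lower_central m.+1) = (y \in long_span gen m).
Proof.
exact: lower_centralP gen_right gen_left gen_comm gen_four gen_ind m y.
Qed.

Lemma root_large i k : (10 <= i + k)%N -> root_elt gen i k = 0.
Proof.
by case: k => [|k] hik /=; rewrite gen_large ?lier0//; lia.
Qed.

(** * Quotients of subgroups *)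

(** The first isomorphism theorem, with the surjectivity of [c] on [H] witnessed
    by a section [s]. *)
Lemma subquot_isog (V W : zmodType) (H K : zmodClosed V) (c : {additive V -> W})
    (s : W -> V) :
  (forall w, s w \in H) -> cancel s c ->
  (forall y, y \in H -> (y \in K) = (c y == 0)) ->
  zmod_isog (subquot H K) W.
Proof.
move=> sH sK kerK.
have traceE (u : subgrp H) : (u \in subgrp_trace H K) = (val u \in K) by [].
have subgrpP (u : subgrp H) : val u \in H by case: u.
have piB : {morph \pi_(subquot H K) : u v / u - v >-> u - v}.
  by move=> u v; rewrite Quotient.pi_add Quotient.pi_opp.
pose f (u : subquot H K) : W := c (val (repr u)).
have fP (h : subgrp H) : f (\pi_(subquot H K) h) = c (val h).
  apply/eqP; rewrite -subr_eq0 /f -raddfB -kerK; last by apply: rpredB.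
  have : repr (\pi_(subquot H K) h) - h \in subgrp_trace H K.
    by rewrite Quotient.idealrBE reprK.
  by rewrite traceE raddfB.
have f_zmod : zmod_morphism f.
  move=> u v; rewrite -[u]reprK -[v]reprK -piB.
  by rewrite !fP !raddfB.
pose F : {additive subquot H K -> W} :=
  HB.pack f (GRing.isZmodMorphism.Build _ _ f f_zmod).
have : bijective f.
  exists (fun w => \pi_(subquot H K) (Subgrp (sH w))) => [u|w].
    rewrite -[u]reprK fP; apply/eqP; rewrite -Quotient.idealrBE.
    rewrite traceE raddfB /= kerK; last by rewrite rpredB ?subgrpP ?sH.
    by rewrite raddfB /= sK subrr.
  by rewrite fP /= sK.
by move=> fbij; exists F.
Qed.

(** * Matrix entries as coordinates *)

Section Coordinates.
Variable toM : L -> gl 11.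
Hypothesis toMD : {morph toM : y z / y + z}.
Hypothesis toML : {morph toM : y z / lie y z}.
Hypothesis toM_gen : forall i, toM (pres_gen relator i) = mgen i.

Lemma toM_root i k :
  (i + k < 10)%N -> toM (root_elt gen i k) = munit i (i + k).+1.
Proof.
elim: k => [|k IHk] hik /=.
  by rewrite gen_small ?toM_gen ?mgen_inord ?addn0//; lia.
rewrite toML IHk; last lia.
rewrite gen_small// toM_gen mgen_inord// lie_munit; try lia.
by rewrite addnS eqxx (_ : _ == i = false) ?mulr0n ?subr0//; apply/eqP; lia.
Qed.

Lemma toM_zmod : zmod_morphism toM.
Proof.
move=> y z; apply: (@addIr _ (toM z)).
by rewrite -toMD subrK addrNK.
Qed.

HB.instance Definition _ := GRing.isZmodMorphism.Build L (gl 11) toM toM_zmod.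

Section Diagonal.
Variable m : nat.
Hypothesis m_lt : (m < 10)%N.

(** The [(m+1)]-st superdiagonal of the image. *)
Definition diag (y : L) : {ffun 'I_(11 - m.+1) -> int} :=
  [ffun j : 'I_(11 - m.+1) => toM y (inord j) (inord (j + m).+1)].

Lemma diag_zmod : zmod_morphism diag.
Proof. by move=> y z; apply/ffunP=> j; rewrite !ffunE raddfB !mxE. Qed.

HB.instance Definition _ := GRing.isZmodMorphism.Build _ _ diag diag_zmod.

Definition undiag (v : {ffun 'I_(11 - m.+1) -> int}) : L :=
  \sum_(j < 11 - m.+1) root_elt gen j m *~ v j.

Lemma undiag_in v : undiag v \in lower_central m.+1.
Proof.
rewrite lower_centralE; apply: rpred_sum => j _.
by apply: rpredMz; apply: root_long.
Qed.

Lemma diag_root i k (j : 'I_(11 - m.+1)) :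
  (i + k < 10)%N ->
  diag (root_elt gen i k) j = ((j == i :> nat) && (k == m))%:R.
Proof.
move=> hik; have hj := ltn_ord j.
by rewrite ffunE toM_root// munitE; lia.
Qed.

Lemma undiagK : cancel undiag diag.
Proof.
move=> v; apply/ffunP=> i; rewrite raddf_sum sum_ffunE (bigD1 i)//= big1.
  have hi := ltn_ord i.
  by rewrite raddfMz ffunMzE diag_root ?eqxx ?addr0 ?intz//; lia.
move=> j /negbTE ji; have hj := ltn_ord j.
rewrite raddfMz ffunMzE diag_root; last lia.
by rewrite eq_sym val_eqE ji mul0rz.
Qed.

Lemma undiag_zmod : zmod_morphism undiag.
Proof.
move=> v w; rewrite /undiag -sumrB; apply: eq_bigr => j _.
by rewrite !ffunE mulrzBr.
Qed.

HB.instance Definition _ := GRing.isZmodMorphism.Build _ _ undiag undiag_zmod.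

Lemma diag_root_off i k : k != m -> diag (root_elt gen i k) = 0.
Proof.
move=> /negbTE km; have [hik|hik] := ltnP (i + k) 10.
  by apply/ffunP => j; rewrite diag_root// km andbF ffunE.
by rewrite root_large// raddf0.
Qed.

(** It suffices to look at root elements: one with [m + 1] letters equals its
    own reconstruction, and a longer one has zero coordinates and already lies
    in the next term. *)
Lemma diagK_mod y :
  y \in lower_central m.+1 -> y - undiag (diag y) \in lower_central m.+2.
Proof.
rewrite !lower_centralE; move: y; apply: zgen_ind => [_ [i [k [mk ->]]]||].
- have [km|km] := eqVneq k m; last first.
    rewrite diag_root_off// raddf0 subr0 root_long//; lia.
  rewrite {}km {mk}; have [him|him] := ltnP (i + m) 10; last first.
    by rewrite root_large// !raddf0 addr0 rpred0.
  have hi : (i < 11 - m.+1)%N by lia.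
  rewrite /undiag (bigD1 (Ordinal hi))//= big1 => [|j ji].
    by rewrite diag_root//= !eqxx mulr1z addr0 subrr rpred0.
  by rewrite diag_root// -[X in _ == X]/(val (Ordinal hi)) val_eqE (negbTE ji).
- by rewrite !raddf0 addr0 rpred0.
- by move=> y z hy hz; rewrite !raddfB addrACA -opprD rpredB.
Qed.

Lemma diag_ker y : y \in lower_central m.+1 ->
  (y \in lower_central m.+2) = (diag y == 0).
Proof.
move=> hy; apply/idP/eqP => [|y0]; last first.
  by have := diagK_mod hy; rewrite y0 raddf0 subr0.
rewrite lower_centralE; move: (y); apply: zgen_ind => [_ [i [k [mk ->]]]||].
- by rewrite diag_root_off//; apply/eqP; lia.
- exact: raddf0.
- by move=> z t hz ht; rewrite raddfB /= hz ht subr0.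
Qed.

Lemma factor_isog : zmod_isog (lower_central_factor L m.+1)
  {ffun 'I_(11 - m.+1) -> int}.
Proof. exact: subquot_isog undiag_in undiagK diag_ker. Qed.

End Diagonal.
End Coordinates.

Theorem theorem6p2 :
  nilpotent_of_class L 10 /\
  forall i : nat, (1 <= i <= 10)%N ->
    zmod_isog (lower_central_factor L i) {ffun 'I_(11 - i) -> int}.
Proof.
have [toM [toMD toML toM_gen]] := toM_exists.
split; last first.
  by case=> // m hm; apply: factor_isog toMD toML toM_gen m hm.
split=> [y|d hd triv].
  rewrite lower_centralE; move: y; apply: zgen_ind => [_ [i [k [mk ->]]]|//|].
    by apply: root_large; lia.
  by move=> y z y0 z0; rewrite y0 z0 subr0.
(* The root element on the letters 0, ..., d lies in the (d+1)-st term and has a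
   nonzero matrix. *)
have /(congr1 toM) : root_elt gen 0 d = 0.
  by apply: triv; rewrite lower_centralE root_long.
rewrite (toM_root toML toM_gen)//.
have -> : toM 0 = 0 by apply: (@addrI _ (toM 0)); rewrite -toMD !addr0.
move/matrixP/(_ (inord 0) (inord d.+1)); rewrite munitE// !mxE !eqxx.
by [].
Qed.
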